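(* Let $\Lambda$ be a finite dimensional algebra over a field $K$, and let $\mathcal F_\infty$ be the class of $\Lambda$-modules (up to isomorphism) of the form $DM$, where $M$ is a finitely generated $\Lambda^{\mathrm{op}}$-module with $k\text{-}\operatorname{ddell}M<\infty$ for all integers $k\ge1$. If $0\to A\to B\to C\to0$ is a short exact sequence of finitely generated $\Lambda$-modules and two of the modules $A,B,C$ are in $\mathcal F_\infty$, then so is the third.
   Context: $D=\mathrm{Hom}_K(-,K)$ is the standard duality between finitely generated right $\Lambda^{\mathrm{op}}$-modules and finitely generated right $\Lambda$-modules. For a finite dimensional algebra $\Gamma$ (here $\Gamma=\Lambda^{\mathrm{op}}$), $\mathrm{mod}\,\Gamma$ is the category of finitely generated right $\Gamma$-modules. $\mathbb N$ is the set of nonnegative integers; the infimum of the empty set is $+\infty$. $\Omega M$ is the kernel of a projective cover of $M$, $\Omega^0M=M$, $\Omega^{n+1}M=\Omega(\Omega^nM)$. ''$U$ is a direct summand of $V$ up to projective summands'' means that $U$ is isomorphic to a direct summand of $V\oplus P$ for some projective $P$. For an integer $j\ge1$, $j\text{-}\operatorname{dell}M$ is the infimum of all $n\in\mathbb N$ such that $\Omega^nM$ is a direct summand of $\Omega^{n+j}N$ up to projective summands for some $N\in\mathrm{mod}\,\Gamma$. $k\text{-}\operatorname{ddell}M$ is the infimum of all $m\in\mathbb N$ for which there exist $0\le n\le m$ and an exact sequence $0\to C_n\to\cdots\to C_1\to C_0\to M\to0$ in $\mathrm{mod}\,\Gamma$ with $(i+k)\text{-}\operatorname{dell}C_i\le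 m-i$ for $i=0,\dots,n$. *)

(* Defs.v *)
From HB Require Import structures.
From mathcomp Require Import all_boot all_order all_algebra all_field.
From mathcomp Require Import boolp.

Set Implicit Arguments.
Unset Strict Implicit.
Unset Printing Implicit Defensive.

Import GRing.Theory.
Local Open Scope ring_scope.

(* The opposite algebra: MathComp equips [A^c] with the converse ring structure
   only; we add the K-algebra and finite dimension structures. *)
Section OppositeAlgebra.
Variables (K : fieldType) (A : falgType K).

HB.instance Definition _ := GRing.Lmodule.copy (A^c) A.

Fact converse_scalerAl (c : K) (u v : A^c) : c *: (u * v) = (c *: u : A^c) * v.
Proof. exact: (@scalerAr K A c v u). Qed.
HB.instance Definition _ :=
  GRing.Lmodule_isLalgebra.Build K (A^c) converse_scalerAl.

Fact converse_scalerAr (c : K) (u v : A^c) : c *: (u * v) = u * (c *: v : A^c).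
Proof. exact: (@scalerAl K A c v u). Qed.
HB.instance Definition _ :=
  GRing.Lalgebra_isAlgebra.Build K (A^c) converse_scalerAr.

HB.instance Definition _ := Vector.copy (A^c) A.
End OppositeAlgebra.

(* Finitely generated right modules over the finite dimensional algebra A,
   presented on their underlying finite dimensional K-vector space. Lemmas
   [rmod_fg] and [fg_rmod] below show that this is no restriction. *)
Record rmod (K : fieldType) (A : falgType K) := RMod {
  rmod_sort :> vectType K;
  ract : rmod_sort -> A -> rmod_sort;
  ract_linearl : forall a, linear (ract^~ a);
  ract_linearr : forall v, linear (ract v);
  ract1 : forall v, ract v 1 = v;
  ractM : forall v a b, ract v (a * b) = ract (ract v a) b
}.

Section FinitelyGenerated.
Variables (K : fieldType) (A : falgType K).

Lemma rmod_fg (X : rmod A) : exists (n : nat) (s : 'I_n -> X),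
  forall x, exists c : 'I_n -> A, x = \sum_i ract (s i) (c i).
Proof.
have ractZ (v : X) c : ract v (c%:A) = c *: v.
  have ract0 : ract v 0 = 0.
    by have := ract_linearr v (-1) 0 0; rewrite scaler0 addr0 scaleN1r addNr.
  by have := ract_linearr v c 1 0; rewrite addr0 ract0 addr0 ract1.
exists (\dim {: X}), (fun i => (vbasis {: X})`_i) => x.
exists (fun i => (coord (vbasis {: X}) i x)%:A).
rewrite {1}(coord_vbasis (memvf x)); apply: eq_bigr => i _.
by rewrite ractZ.
Qed.

(* [lmodType A^c] is MathComp's type of (not necessarily finitely generated)
   left modules over the opposite of A, that is, of right A-modules. *)
Lemma fg_rmod (M : lmodType A^c) (n : nat) (s : 'I_n -> M) :
    (forall m, exists c : 'I_n -> A^c, m = \sum_i c i *: s i) ->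
  exists (X : rmod A) (phi : X -> M),
    [/\ forall x y, phi (x + y) = phi x + phi y,
        forall x a, phi (ract x a) = (a : A^c) *: phi x
      & bijective phi].
Proof.
move=> gen; pose F : vectType K := {ffun 'I_n -> A}.
pose phi (f : F) : M := \sum_i (f i : A^c) *: s i.
have phiP c (f g : F) : phi (c *: f + g) = (c%:A : A^c) *: phi f + phi g.
  rewrite /phi scaler_sumr -big_split /=; apply: eq_bigr => i _.
  rewrite !ffunE scalerA -scalerDl; congr ((_ + _) *: _).
  by rewrite -[RHS]/((f i : A) * (c *: 1)) -scalerAr mulr1.
have phi0 : phi 0 = 0.
  by rewrite /phi big1 // => i _; rewrite ffunE scale0r.
have phiB (f g : F) : phi (f - g) = phi f - phi g.
  have -> : f - g = -1 *: g + f by rewrite scaleN1r addrC.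
  by rewrite phiP scaleN1r scaleN1r addrC.
pose free (W : {vspace F}) := forall w, w \in W -> phi w = 0 -> w = 0.
have [W freeW maxW] : exists2 W, free W &
    forall W', free W' -> (\dim W' <= \dim W)%N.
  pose Q d := `[< exists2 W, free W & \dim W = d >].
  have exQ : exists d, Q d.
    by exists 0%N; apply/asboolP; exists 0%VS; rewrite ?dimv0 // => w /vlineP[c ->];
       rewrite scaler0.
  have bQ d : Q d -> (d <= \dim {: F})%N.
    by move/asboolP=> [W _ <-]; apply/dimvS/subvf.
  have [d /asboolP[W fW <-] maxd] := ex_maxnP exQ bQ.
  by exists W => // W' fW'; apply: maxd; apply/asboolP; exists W'.
have surjW m : exists w : subvs_of W, phi (vsval w) == m.
  have [c ->] := gen m; pose f : F := [ffun i => c i].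
  have -> : \sum_i c i *: s i = phi f.
    by rewrite /phi; apply: eq_bigr => i _; rewrite ffunE.
  have [fW|fNW] := boolP (f \in W).
    by exists (vsproj W f); rewrite vsprojK.
  have /existsNP[w] : ~ free (W + <[f]>)%VS.
    move/maxW => le; case/negP: fNW.
    have /eqP -> : (W == W + <[f]>)%VS by rewrite eqEdim addvSl.
    by rewrite memvE addvSr.
  move=> /not_implyP[/memv_addP[u uW [_ /vlineP[c0 ->] w1]]] /not_implyP[w0 nz].
  move: w0 nz; rewrite w1 => w0 nz.
  have c0nz : c0 != 0.
    apply/eqP => c00; apply: nz; move: w0.
    by rewrite c00 scale0r addr0; apply: freeW.
  exists (vsproj W (- c0^-1 *: u)); rewrite vsprojK ?memvZ //.
  have -> : - c0^-1 *: u = f - c0^-1 *: (u + c0 *: f).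
    by rewrite scalerDr scalerA mulVf // scale1r opprD addrCA subrr addr0 scaleNr.
  rewrite phiB -[c0^-1 *: _]addr0 phiP w0 phi0 addr0 scaler0 subr0.
  exact: eqxx.
have injW (u v : subvs_of W) : phi (vsval u) = phi (vsval v) -> u = v.
  move=> eq; apply/subr0_eq/val_inj; apply: freeW; first exact: subvsP.
  by rewrite linearB phiB eq subrr.
pose inv m := xchoose (surjW m).
have invK m : phi (vsval (inv m)) = m by apply/eqP/(xchooseP (surjW m)).
pose act (w : subvs_of W) (a : A) := inv ((a : A^c) *: phi (vsval w)).
have actl a : linear (act^~ a).
  move=> c u v; apply: injW; rewrite linearP phiP !invK linearP phiP.
  rewrite scalerDr !scalerA; congr (_ *: _ + _).
  by rewrite -[LHS]/(c%:A * a) -[RHS]/(a * c%:A) -scalerAl -scalerAr mul1r mulr1.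
have actr w : linear (act w).
  move=> c a b; apply: injW; rewrite linearP phiP !invK scalerDl scalerA.
  by congr (_ *: _ + _); rewrite -[RHS]/(a * c%:A) -scalerAr mulr1.
have act1 w : act w 1 = w by apply: injW; rewrite invK scale1r.
have actM w a b : act w (a * b) = act (act w a) b.
  by apply: injW; rewrite !invK scalerA.
exists (@RMod K A (subvs_of W) act actl actr act1 actM), (fun w => phi (vsval w)).
split=> [x y|x a|]; last 1 first.
- by exists inv => [w|m]; [apply: injW|]; rewrite invK.
- by have := phiP 1 (vsval x) (vsval y); rewrite !scale1r linearD.
by rewrite invK.
Qed.

End FinitelyGenerated.

Section Modules.
Variables (K : fieldType) (A : falgType K).
Implicit Types M N P U V W X Y : rmod A.

Definition is_rhom M N (f : 'Hom(M, N)) : Prop :=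
  forall v a, f (ract v a) = ract (f v) a.

Definition inj_hom M N (f : 'Hom(M, N)) : Prop := lker f = 0%VS.
Definition surj_hom M N (f : 'Hom(M, N)) : Prop := limg f = fullv.
Definition exact_at M N X (f : 'Hom(M, N)) (g : 'Hom(N, X)) : Prop :=
  limg f = lker g.

Definition short_exact M N X (f : 'Hom(M, N)) (g : 'Hom(N, X)) : Prop :=
  [/\ is_rhom f, is_rhom g, inj_hom f, exact_at f g & surj_hom g].

Definition rmod_iso M N : Prop :=
  exists f : 'Hom(M, N), [/\ is_rhom f, inj_hom f & surj_hom f].

Definition is_submod M (U : {vspace M}) : Prop :=
  forall v a, v \in U -> ract v a \in U.

Section DirectSum.
Variables M N : rmod A.

Definition dsum_act (v : M * N) (a : A) : M * N := (ract v.1 a, ract v.2 a).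

Fact dsum_linearl a : linear (dsum_act^~ a).
Proof. by move=> c u v; rewrite /dsum_act !ract_linearl. Qed.
Fact dsum_linearr v : linear (dsum_act v).
Proof. by move=> c a b; rewrite /dsum_act !ract_linearr. Qed.
Fact dsum_act1 v : dsum_act v 1 = v.
Proof. by case: v => u v; rewrite /dsum_act !ract1. Qed.
Fact dsum_actM v a b : dsum_act v (a * b) = dsum_act (dsum_act v a) b.
Proof. by rewrite /dsum_act !ractM. Qed.

Definition dsum : rmod A :=
  @RMod K A (M * N)%type dsum_act dsum_linearl dsum_linearr dsum_act1 dsum_actM.
End DirectSum.

Definition projective P : Prop :=
  forall X Y (g : 'Hom(X, Y)) (f : 'Hom(P, Y)),
    is_rhom g -> is_rhom f -> surj_hom g ->
    exists h : 'Hom(P, X), is_rhom h /\ (g \o h)%VF = f.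

Definition superfluous M (S : {vspace M}) : Prop :=
  forall U : {vspace M}, is_submod U -> (U + S)%VS = fullv -> U = fullv.

Definition proj_cover P M (p : 'Hom(P, M)) : Prop :=
  [/\ projective P, is_rhom p, surj_hom p & superfluous (lker p)].

(* S is (isomorphic to) the kernel of a projective cover of M. *)
Definition is_Omega M (S : rmod A) : Prop :=
  exists (P : rmod A) (i : 'Hom(S, P)) (p : 'Hom(P, M)),
    proj_cover p /\ short_exact i p.

(* S is (isomorphic to) the n-th syzygy of M; projective covers being unique up
   to isomorphism, so is S. *)
Fixpoint is_OmegaN (n : nat) M (S : rmod A) : Prop :=
  if n is n'.+1 then exists T, is_OmegaN n' M T /\ is_Omega T S
  else rmod_iso S M.

Definition direct_summand U V : Prop := exists W, rmod_iso (dsum U W) V.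

Definition stable_summand U V : Prop :=
  exists P, projective P /\ direct_summand U (dsum V P).

End Modules.

(* Infimum in the extended naturals, [None] standing for +oo. *)
Definition enat_inf (P : nat -> Prop) : option nat :=
  if pselect (exists n, `[< P n >]) is left exP then Some (ex_minn exP)
  else None.

Definition enat_le (x : option nat) (m : nat) : bool :=
  if x is Some n then (n <= m)%N else false.

Lemma enat_inf_leP (P : nat -> Prop) (m : nat) :
  enat_le (enat_inf P) m <-> exists2 n, (n <= m)%N & P n.
Proof.
rewrite /enat_inf; case: pselect => [exP|nexP] /=.
  case: ex_minnP => n /asboolP Pn minn; split=> [lenm|[i leim Pi]].
    by exists n.
  by apply: leq_trans leim; apply: minn; apply/asboolP.
by split=> // -[n _ Pn]; case: nexP; exists n; apply/asboolP.
Qed.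

Lemma enat_inf_fin (P : nat -> Prop) : enat_inf P <> None <-> exists n, P n.
Proof.
rewrite /enat_inf; case: pselect => [exP|nexP]; split=> //.
  by move=> _; case: exP => n /asboolP; exists n.
by case=> n Pn; case: nexP; exists n; apply/asboolP.
Qed.

Section Dell.
Variables (K : fieldType) (A : falgType K).
Implicit Types M N : rmod A.

Definition dell (j : nat) M : option nat :=
  enat_inf (fun n => exists N S T,
    [/\ is_OmegaN n M S, is_OmegaN (n + j) N T & stable_summand S T]).

(* An exact sequence 0 -> C_n -> ... -> C_0 -> M -> 0, continued on the left by
   C_i = 0 for i > n. *)
Definition resolution (n : nat) M (C : nat -> rmod A)
    (d : forall i, 'Hom(C i.+1, C i)) (e : 'Hom(C 0%N, M)) : Prop :=
  [/\ forall i, (n < i)%N -> \dim {: C i} = 0%N,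
      is_rhom e /\ (forall i, is_rhom (d i)),
      surj_hom e,
      exact_at (d 0%N) e
    & forall i, exact_at (d i.+1) (d i)].

Definition ddell (k : nat) M : option nat :=
  enat_inf (fun m => exists n, (n <= m)%N /\
    exists C d e, @resolution n M C d e /\
      forall i, (i <= n)%N -> enat_le (dell (i + k) (C i)) (m - i)).

End Dell.

(* The standard duality D = Hom_K(-, K): a right A^c-module M is sent to the
   right A-module Hom_K(M, K), with (f a)(v) = f (v a). *)
Section Duality.
Variables (K : fieldType) (A : falgType K) (M : rmod A^c).

Definition dual_act (f : 'Hom(M, K^o)) (a : A) : 'Hom(M, K^o) :=
  linfun (fun v : M => f (ract v (a : A^c))).

Fact dual_act_linear (f : 'Hom(M, K^o)) (a : A) :
  linear (fun v : M => f (ract v (a : A^c))).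
Proof. by move=> c u v; rewrite ract_linearl linearP. Qed.

Lemma dual_actE f a v : dual_act f a v = f (ract v (a : A^c)).
Proof.
pose h := GRing.isLinear.Build K M K^o _ _ (dual_act_linear f a).
pose l : {linear M -> K^o} := HB.pack (fun v : M => f (ract v (a : A^c))) h.
exact: (lfunE l).
Qed.

Fact dual_linearl a : linear (dual_act^~ a).
Proof.
by move=> c f g; apply/lfunP=> v; rewrite !(dual_actE, add_lfunE, scale_lfunE).
Qed.
Fact dual_linearr f : linear (dual_act f).
Proof.
move=> c a b; apply/lfunP=> v; rewrite !(dual_actE, add_lfunE, scale_lfunE).
by rewrite (ract_linearr v c (a : A^c) b) linearP.
Qed.
Fact dual_act1 f : dual_act f 1 = f.
Proof. by apply/lfunP=> v; rewrite dual_actE (ract1 v). Qed.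
Fact dual_actM f a b : dual_act f (a * b) = dual_act (dual_act f a) b.
Proof.
apply/lfunP=> v; rewrite !dual_actE.
by rewrite -(ractM v (b : A^c) (a : A^c)).
Qed.

Definition dual : rmod A :=
  @RMod K A 'Hom(M, K^o) dual_act dual_linearl dual_linearr dual_act1 dual_actM.
End Duality.

Definition F_infty (K : fieldType) (L : falgType K) (X : rmod L) : Prop :=
  exists M : rmod L^c,
    (forall k : nat, (1 <= k)%N -> ddell k M <> None) /\ rmod_iso X (dual M).

(* Main.v *)
(* Call M good at level k if it has a finite resolution whose i-th term has
   finite (i+k)-dell; this is finiteness of k-ddell. Dualizing, the claim is
   that the modules good at every level satisfy two-out-of-three.

   Finiteness of j-dell passes to stable retracts and to syzygies, hence
   goodness at level k passes to suitable syzygies by a horseshoe argument.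
   For 0 -> M -> N -> X -> 0, a presentation 0 -> S -> P -> X -> 0 with P
   projective yields 0 -> S -> M + P -> N -> 0. Pulling the first step
   C_0 -> M of a resolution back along this sequence covers N by C_0 + P, with
   kernel an extension of S by the next kernel of that resolution; induction on
   its length gives closure under extensions. Cokernels reduce to extensions by
   the same pullback, and kernels reduce to both, since M + P is an extension of
   N by S and M is the cokernel of P -> M + P. *)

Require Import Defs.
From HB Require Import structures.
From mathcomp Require Import all_boot all_order all_algebra all_field.
From mathcomp Require Import boolp.

Set Implicit Arguments.
Unset Strict Implicit.
Unset Printing Implicit Defensive.

Import GRing.Theory.
Local Open Scope ring_scope.

Lemma linfun_of (K : fieldType) (V W : vectType K) (F : V -> W) : linear F -> linfun F =1 F.
Proof.
move=> lF; pose l : {linear V -> W} := HB.pack F (GRing.isLinear.Build K V W _ F lF).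
exact: (lfunE l).
Qed.

(** * Module homomorphisms, submodules and direct sums *)

Section Homomorphisms.
Variables (K : fieldType) (A : falgType K).
Implicit Types M N P Q S T U V W X Y Z : rmod A.

Lemma ractD M (x y : M) a : ract (x + y) a = ract x a + ract y a.
Proof. by have := ract_linearl a 1 x y; rewrite !scale1r. Qed.

Lemma ract0 M a : ract (0 : M) a = 0.
Proof. by apply: (addrI (ract (0 : M) a)); rewrite -ractD !addr0. Qed.

Lemma ractN M (x : M) a : ract (- x) a = - ract x a.
Proof. by apply/eqP; rewrite -addr_eq0 -ractD addNr ract0. Qed.

Lemma injP M N (f : 'Hom(M, N)) : inj_hom f <-> injective f.
Proof.
split=> [/eqP f0 | inj]; first exact/lker0P.
by apply/eqP/lker0P.
Qed.

Lemma surjP M N (f : 'Hom(M, N)) : surj_hom f <-> forall y, exists x, f x = y.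
Proof.
split=> [sf y | sf].
  by have /memv_imgP[x _ ->] : y \in limg f by [rewrite sf memvf]; exists x.
by apply/vspaceP=> y; rewrite memvf; have [x <-] := sf y; rewrite memv_img ?memvf.
Qed.

Lemma exactP M N X (f : 'Hom(M, N)) (g : 'Hom(N, X)) :
  exact_at f g <-> forall y, g y = 0 <-> exists x, f x = y.
Proof.
split=> [E y | E].
  split=> [gy | [x <-]].
    have /memv_imgP[x _ ->] : y \in limg f by rewrite E memv_ker gy.
    by exists x.
  by apply/eqP; rewrite -memv_ker -E memv_img ?memvf.
apply/vspaceP=> y; rewrite memv_ker; apply/memv_imgP/eqP.
  by case=> x _ ->; apply/E; exists x.
by move/E=> [x <-]; exists x; rewrite ?memvf.
Qed.

Lemma exact0 M N X (f : 'Hom(M, N)) (g : 'Hom(N, X)) x :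
  exact_at f g -> g (f x) = 0.
Proof. by move/exactP=> E; apply/E; exists x. Qed.

Lemma rhom_of M N (F : M -> N) :
    linear F -> (forall x a, F (ract x a) = ract (F x) a) ->
  exists2 f : 'Hom(M, N), is_rhom f & f =1 F.
Proof.
move=> lF rF.
by exists (linfun F) => [v a|]; rewrite ?(linfun_of lF) //; apply: linfun_of.
Qed.

Lemma rhom_comp M N X (f : 'Hom(M, N)) (g : 'Hom(N, X)) :
  is_rhom f -> is_rhom g -> is_rhom (g \o f)%VF.
Proof. by move=> rf rg v a; rewrite !comp_lfunE rf rg. Qed.

Lemma rhom_id M : @is_rhom K A M M \1%VF.
Proof. by move=> v a; rewrite !id_lfunE. Qed.

Lemma rhom0 M N : @is_rhom K A M N 0.
Proof. by move=> v a; rewrite !zero_lfunE ract0. Qed.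

Lemma rhomD M N (f g : 'Hom(M, N)) : is_rhom f -> is_rhom g -> is_rhom (f + g).
Proof. by move=> rf rg v a; rewrite !add_lfunE rf rg ractD. Qed.

Lemma rhomN M N (f : 'Hom(M, N)) : is_rhom f -> is_rhom (- f).
Proof. by move=> rf v a; rewrite !opp_lfunE rf ractN. Qed.

(** The pseudo-inverse [i^-1] is [K]-linear and inverts [i] on its image; injectivity of [i] then
    makes the factor compatible with the action. *)
Lemma rhom_fact M N X (i : 'Hom(M, N)) (f : 'Hom(X, N)) :
    is_rhom i -> inj_hom i -> is_rhom f ->
    (forall x, exists y, i y = f x) ->
  exists2 h : 'Hom(X, M), is_rhom h & forall x, i (h x) = f x.
Proof.
move=> ri /injP ii rf im.
have iV x : i ((i^-1)%VF (f x)) = f x.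
  by apply: limg_lfunVK; have [y <-] := im x; rewrite memv_img ?memvf.
exists (i^-1 \o f)%VF => [v a|x]; last by rewrite comp_lfunE iV.
by apply: ii; rewrite !comp_lfunE ri !iV.
Qed.

Lemma rhom_inv M N (f : 'Hom(M, N)) :
    is_rhom f -> inj_hom f -> surj_hom f ->
  exists g : 'Hom(N, M), [/\ is_rhom g, cancel f g & cancel g f].
Proof.
move=> rf jf /surjP sf.
have [|g rg gE] := rhom_fact rf jf (@rhom_id N).
  by move=> x; rewrite id_lfunE; apply: sf.
have gK : cancel g f by move=> x; rewrite gE id_lfunE.
by exists g; split=> // x; move/injP: jf => jf; apply: jf; rewrite gK.
Qed.

Lemma iso_of_cancel M N (f : 'Hom(M, N)) (g : 'Hom(N, M)) :
  is_rhom f -> cancel f g -> cancel g f -> rmod_iso M N.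
Proof.
move=> rf fK gK; exists f; split=> //; first exact/injP/(can_inj fK).
by apply/surjP=> y; exists (g y).
Qed.

Lemma iso_inv M N : rmod_iso M N ->
  exists (f : 'Hom(M, N)) (g : 'Hom(N, M)),
    [/\ is_rhom f, is_rhom g, cancel f g & cancel g f].
Proof.
by move=> [f [rf jf sf]]; have [g [rg fK gK]] := rhom_inv rf jf sf; exists f, g.
Qed.

Lemma iso_refl M : rmod_iso M M.
Proof.
by apply: (@iso_of_cancel M M \1%VF \1%VF); [exact: rhom_id|move=> x|move=> x];
   rewrite !id_lfunE.
Qed.

Lemma iso_sym M N : rmod_iso M N -> rmod_iso N M.
Proof. by move/iso_inv=> [f [g [rf rg fK gK]]]; apply: (iso_of_cancel rg). Qed.

Lemma submod_rmod M (U : {vspace M}) : is_submod U ->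
  exists (S : rmod A) (i : 'Hom(S, M)), [/\ is_rhom i, inj_hom i & limg i = U].
Proof.
move=> sU; pose act (w : subvs_of U) a := vsproj U (ract (vsval w) a).
have actE w a : vsval (act w a) = ract (vsval w) a.
  by rewrite vsprojK // sU ?subvsP.
have al a : linear (act^~ a).
  by move=> c u v; apply: subvs_inj; rewrite actE !linearP /= ract_linearl -!actE.
have ar w : linear (act w).
  by move=> c a b; apply: subvs_inj; rewrite actE ract_linearr !linearP /= -!actE.
have a1 w : act w 1 = w by apply: subvs_inj; rewrite actE ract1.
have aM w a b : act w (a * b) = act (act w a) b.
  by apply: subvs_inj; rewrite !actE ractM.
pose S := @RMod K A (subvs_of U) act al ar a1 aM.
have [i ri iE] : exists2 i : 'Hom(S, M), is_rhom i & i =1 vsval.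
  by apply: rhom_of => [c x y|x a]; [exact: linearP|exact: actE].
exists S, i; split=> //; first by apply/injP=> x y; rewrite !iE => /subvs_inj.
apply/vspaceP=> x; apply/memv_imgP/idP=> [[y _ ->]|xU].
  by rewrite iE subvsP.
by exists (vsproj U x); rewrite ?memvf // iE vsprojK.
Qed.

Lemma ker_submod M N (f : 'Hom(M, N)) : is_rhom f -> is_submod (lker f).
Proof. by move=> rf v a; rewrite !memv_ker rf => /eqP->; rewrite ract0. Qed.

Lemma img_submod M N (f : 'Hom(M, N)) : is_rhom f -> is_submod (limg f).
Proof.
by move=> rf v a /memv_imgP[x _ ->]; rewrite -rf memv_img ?memvf.
Qed.

Lemma ker_rmod M N (f : 'Hom(M, N)) : is_rhom f ->
  exists S (i : 'Hom(S, M)), [/\ is_rhom i, inj_hom i & exact_at i f].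
Proof. by move/ker_submod/submod_rmod. Qed.

Lemma short_exact_ker M N (f : 'Hom(M, N)) : is_rhom f -> surj_hom f ->
  exists S (i : 'Hom(S, M)), short_exact i f.
Proof. by move=> rf sf; have [S [i [ri ii e]]] := ker_rmod rf; exists S, i. Qed.

Lemma zero_rmod M : exists Z : rmod A, forall z : Z, z = 0.
Proof.
have s0 : is_submod (0%VS : {vspace M}).
  by move=> v a; rewrite !memv0 => /eqP->; rewrite ract0.
have [Z [i [_ /injP ii iE]]] := submod_rmod s0; exists Z => z.
apply: ii; rewrite linear0; apply/eqP.
by rewrite -memv0 -iE memv_img ?memvf.
Qed.

Lemma dsum_rhoms M N :
  exists (i1 : 'Hom(M, dsum M N)) (i2 : 'Hom(N, dsum M N))
         (p1 : 'Hom(dsum M N, M)) (p2 : 'Hom(dsum M N, N)),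
    [/\ is_rhom i1, is_rhom i2, is_rhom p1 & is_rhom p2] /\
    [/\ forall x, i1 x = (x, 0), forall y, i2 y = (0, y),
        forall z, p1 z = z.1 & forall z, p2 z = z.2].
Proof.
have [i1 r1 E1] : exists2 f : 'Hom(M, dsum M N),
    is_rhom f & f =1 (fun x => (x, 0)).
  apply: rhom_of => [c x y|x a]; last by rewrite /= /dsum_act /= ract0.
  by congr pair; rewrite /= scaler0 addr0.
have [i2 r2 E2] : exists2 f : 'Hom(N, dsum M N),
    is_rhom f & f =1 (fun x => (0, x)).
  apply: rhom_of => [c x y|x a]; last by rewrite /= /dsum_act /= ract0.
  by congr pair; rewrite /= scaler0 addr0.
have [p1 s1 F1] : exists2 f : 'Hom(dsum M N, M), is_rhom f & f =1 fst.
  by apply: rhom_of.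
have [p2 s2 F2] : exists2 f : 'Hom(dsum M N, N), is_rhom f & f =1 snd.
  by apply: rhom_of.
by exists i1, i2, p1, p2.
Qed.

Lemma rhom_row M N X (f : 'Hom(M, X)) (g : 'Hom(N, X)) :
    is_rhom f -> is_rhom g ->
  exists2 h : 'Hom(dsum M N, X), is_rhom h & forall z, h z = f z.1 + g z.2.
Proof.
move=> rf rg; apply: rhom_of => [c x y|x a].
  by rewrite !linearP /= scalerDr addrACA.
by rewrite /= rf rg ractD.
Qed.

Lemma rhom_col M N X (f : 'Hom(X, M)) (g : 'Hom(X, N)) :
    is_rhom f -> is_rhom g ->
  exists2 h : 'Hom(X, dsum M N), is_rhom h & forall x, h x = (f x, g x).
Proof.
move=> rf rg; apply: rhom_of => [c x y|x a].
  by rewrite !linearP.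
by rewrite /= rf rg.
Qed.

End Homomorphisms.

(** * Projective modules and projective covers *)

Section Projectives.
Variables (K : fieldType) (A : falgType K).
Implicit Types M N P Q S T U V W X Y Z : rmod A.

Lemma projective_lift P X Y (g : 'Hom(X, Y)) (f : 'Hom(P, Y)) :
    projective P -> is_rhom g -> is_rhom f -> surj_hom g ->
  exists2 h : 'Hom(P, X), is_rhom h & forall x, g (h x) = f x.
Proof.
move=> pP rg rf sg; have [h [rh E]] := pP _ _ _ _ rg rf sg.
by exists h => // x; rewrite -E comp_lfunE.
Qed.

Lemma projective_retract P U (i : 'Hom(U, P)) (r : 'Hom(P, U)) :
    projective P -> is_rhom i -> is_rhom r -> cancel i r -> projective U.
Proof.
move=> pP ri rr iK X Y g f rg rf sg.
have [h rh hE] := projective_lift pP rg (rhom_comp rr rf) sg.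
exists (h \o i)%VF; split; first exact: rhom_comp.
by apply/lfunP=> x; rewrite !comp_lfunE hE comp_lfunE iK.
Qed.

Lemma projective_dsum P Q : projective P -> projective Q -> projective (dsum P Q).
Proof.
move=> pP pQ X Y g f rg rf sg.
have [i1 [i2 [_ [_ [[r1 r2 _ _] [E1 E2 _ _]]]]]] := dsum_rhoms P Q.
have [h1 rh1 hE1] := projective_lift pP rg (rhom_comp r1 rf) sg.
have [h2 rh2 hE2] := projective_lift pQ rg (rhom_comp r2 rf) sg.
have [h rh hE] := rhom_row rh1 rh2.
exists h; split=> //; apply/lfunP=> -[x y]; rewrite comp_lfunE hE linearD /=.
rewrite hE1 hE2 !comp_lfunE E1 E2 -linearD; congr (f (_, _)).
  exact: addr0.
exact: add0r.
Qed.

Fact regular_linearl (a : A) : linear (fun x : A => x * a).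
Proof. by move=> c x y; rewrite mulrDl scalerAl. Qed.
Fact regular_linearr (x : A) : linear (fun a : A => x * a).
Proof. by move=> c a b; rewrite mulrDr scalerAr. Qed.

Definition regular_rmod : rmod A :=
  @RMod K A A (fun x a => x * a) regular_linearl regular_linearr
    (@mulr1 A) (@mulrA A).

Lemma regular_rhom M (m : M) :
  exists2 f : 'Hom(regular_rmod, M), is_rhom f & forall a, f a = ract m a.
Proof.
apply: rhom_of => [c x y|x a]; first exact: ract_linearr.
exact: ractM.
Qed.

(** A homomorphism out of the regular module is determined by the image of 1, so it suffices to lift
    that one element. *)
Lemma projective_regular : projective regular_rmod.
Proof.
move=> X Y g f rg rf /surjP sg.
have [x gx] := sg (f 1).
have [h rh hE] := regular_rhom x.
exists h; split=> //; apply/lfunP=> a.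
by rewrite comp_lfunE hE rg gx -rf /= mul1r.
Qed.

Lemma projective_zero Z : (forall z : Z, z = 0) -> projective Z.
Proof.
move=> z0 X Y g f rg rf sg; exists 0; split; first exact: rhom0.
by apply/lfunP=> x; rewrite (z0 x) !linear0.
Qed.

(** One copy of the regular module is taken for each vector of a [K]-basis of [M], by induction on
    the list of basis vectors. *)
Lemma projective_onto M :
  exists P (p : 'Hom(P, M)), [/\ projective P, is_rhom p & surj_hom p].
Proof.
suff [P [p [pP rp sp]]] : exists P (p : 'Hom(P, M)), [/\ projective P, is_rhom p &
    {subset (vbasis {: M} : seq M) <= limg p}].
  exists P, p; split=> //; apply/eqP; rewrite eqEsubv subvf /=.
  by rewrite -(span_basis (vbasisP {: M})); apply/span_subvP.
elim: (tval _) => [|m s [P [p [pP rp sp]]]].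
  have [Z z0] := zero_rmod M; exists Z, 0.
  by split; [exact: projective_zero|exact: rhom0|].
have [q rq qE] := regular_rhom m; have [h rh hE] := rhom_row rp rq.
exists (dsum P regular_rmod), h; split=> //.
  exact: projective_dsum projective_regular.
move=> x; rewrite inE => /orP[/eqP->|/sp/memv_imgP[y _ ->]]; apply/memv_imgP.
  by exists (0, 1); rewrite ?memvf // hE /= linear0 add0r qE ract1.
by exists (y, 0); rewrite ?memvf // hE /= linear0 addr0.
Qed.

(* A submodule U of a projective P of minimal dimension among those mapping
   onto M is a retract: lifting p along U -> M gives P -> U, whose restriction
   to U still covers M and is therefore bijective. *)
Lemma proj_cover_exists M : exists P (p : 'Hom(P, M)), proj_cover p.
Proof.
have [P [p [pP rp sp]]] := projective_onto M.
pose onto d := `[< exists U (i : 'Hom(U, P)), [/\ is_rhom i, inj_hom i,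
  surj_hom (p \o i)%VF & \dim {: U} = d] >].
have ex : exists d, onto d.
  exists (\dim {: P}); apply/asboolP; exists P, \1%VF.
  split=> //; [exact: rhom_id | by apply/injP=> x y; rewrite !id_lfunE |].
  by rewrite comp_lfun1r.
have [d /asboolP[U [i [ri ji si dU]]] mind] := ex_minnP ex.
have rpi := rhom_comp ri rp.
have minU V (j : 'Hom(V, U)) :
    is_rhom j -> inj_hom j -> surj_hom ((p \o i) \o j)%VF -> surj_hom j.
  move=> rj /injP jj sj; apply/eqP; rewrite eqEdim subvf /=.
  have jij : injective (i \o j)%VF.
    by move/injP: ji => ji x y; rewrite !comp_lfunE => /ji/jj.
  have -> : \dim (limg j) = \dim {: V}.
    by apply: limg_dim_eq; move/injP: jj => ->; rewrite capv0.
  rewrite dU; apply: mind; apply/asboolP; exists V, (i \o j)%VF.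
  by split; rewrite ?comp_lfunA //; [exact: rhom_comp|exact/injP].
have minS (S : {vspace U}) :
    is_submod S -> ((p \o i) @: S)%VS = fullv -> S = fullv.
  move=> sS pS; have [V [j [rj jj jE]]] := submod_rmod sS.
  by rewrite -jE; apply: (minU V j) => //; rewrite /surj_hom limg_comp jE.
have [h rh hE] := projective_lift pP rpi rp si.
have rhi := rhom_comp ri rh.
have shi : surj_hom (h \o i)%VF.
  apply: minS; first exact: img_submod.
  rewrite -limg_comp (_ : ((p \o i) \o (h \o i) = p \o i)%VF) //.
  by apply/lfunP=> x; rewrite comp_lfunE (comp_lfunE h i) hE comp_lfunE.
(* A surjective endomorphism of a finite dimensional space is injective, by rank-nullity. *)
have jhi : inj_hom (h \o i)%VF.
  apply/eqP; rewrite -dimv_eq0 -(eqn_add2r (\dim (limg (h \o i)%VF))) add0n.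
  by rewrite -{1}(capfv (lker _)) limg_ker_dim shi.
have [k [rk hiK kK]] := rhom_inv rhi jhi shi.
exists U, (p \o i)%VF; split=> //.
  apply: (@projective_retract P U i (k \o h)%VF) => //; first exact: rhom_comp.
  by move=> x; rewrite comp_lfunE -{2}(hiK x) comp_lfunE.
(* If [V] and the kernel of [p \o i] together span [U], then [V] still maps onto [M], and minimality
   forces [V] to be all of [U]. *)
move=> V sV VE; apply: minS => //.
apply/eqP; rewrite eqEsubv subvf /= -si -VE limgD subv_add subvv /=.
apply/subvP=> y /memv_imgP[x]; rewrite memv_ker => /eqP-> ->.
exact: mem0v.
Qed.

(* Unlike [is_Omega], the projective presentation need not be minimal: syzygies
   in this sense are unique only up to projective summands. *)
Definition is_syz M S : Prop := exists P (i : 'Hom(S, P)) (p : 'Hom(P, M)),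
  projective P /\ short_exact i p.

Fixpoint is_syzN n M S : Prop :=
  if n is n'.+1 then exists T, is_syzN n' M T /\ is_syz T S
  else rmod_iso S M.

(** * Syzygies and stable retracts *)

Lemma Omega_syz M S : is_Omega M S -> is_syz M S.
Proof. by move=> [P [i [p [[pP _ _ _] se]]]]; exists P, i, p. Qed.

Lemma OmegaN_syzN n M S : is_OmegaN n M S -> is_syzN n M S.
Proof.
elim: n S => // n IH S [T [/IH sT /Omega_syz sS]]; by exists T.
Qed.

Lemma OmegaN_exists n M : exists S, is_OmegaN n M S.
Proof.
elim: n => [|n [T oT]]; first by exists M; apply: iso_refl.
have [P [p pc]] := proj_cover_exists T.
have [_ rp sp _] := pc; have [S [i se]] := short_exact_ker rp sp.
by exists S, T; split=> //; exists P, i, p.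
Qed.

Lemma syz_exists M : exists S, is_syz M S.
Proof.
have [P [p [pP rp sp]]] := projective_onto M.
by have [S [i se]] := short_exact_ker rp sp; exists S, P, i, p.
Qed.

Lemma syzN_exists n M : exists S, is_syzN n M S.
Proof. by have [S /OmegaN_syzN] := OmegaN_exists n M; exists S. Qed.

(** The recursion of [is_syzN] appends syzygies at the far end; here one is inserted next to [M]. In
    the base case the isomorphism of [S] with [X] is absorbed into the inclusion of the
    presentation. *)
Lemma syzN_syz n M X S : is_syz M X -> is_syzN n X S -> is_syzN n.+1 M S.
Proof.
move=> sX; elim: n S => [|n IH] S /=.
  move=> /iso_inv[f [g [rf rg fK gK]]].
  exists M; split; first exact: iso_refl.
  have [P [i [p [pP [ri rp ii e sp]]]]] := sX.
  exists P, (i \o f)%VF, p; split=> //; split=> //; first exact: rhom_comp.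
    by apply/injP=> x y; rewrite !comp_lfunE => /(injP i).1 - /(_ ii)/(can_inj fK).
  apply/exactP=> y; rewrite ((exactP _ _).1 e); split=> -[x <-].
    by exists (g x); rewrite comp_lfunE gK.
  by exists (f x); rewrite comp_lfunE.
by move=> [Y [/IH sY sS]]; exists Y.
Qed.

(** A retract in the category of modules modulo maps factoring through projectives. No complement is
    mentioned, so such data compose and lift directly. *)
Definition stable_retract U V : Prop :=
  exists Q (i : 'Hom(U, V)) (r : 'Hom(V, U)) (a : 'Hom(U, Q)) (b : 'Hom(Q, U)),
    [/\ projective Q, is_rhom i, is_rhom r, is_rhom a & is_rhom b] /\
    forall x, r (i x) + b (a x) = x.

Lemma retract_stable U V (i : 'Hom(U, V)) (r : 'Hom(V, U)) :
  is_rhom i -> is_rhom r -> cancel i r -> stable_retract U V.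
Proof.
move=> ri rr iK; have [Z z0] := zero_rmod U.
exists Z, i, r, 0, 0; split; last by move=> x; rewrite iK zero_lfunE addr0.
by split=> //; [exact: projective_zero|exact: rhom0|exact: rhom0].
Qed.

Lemma iso_stable U V : rmod_iso U V -> stable_retract U V.
Proof. by move/iso_inv=> [f [g [rf rg fK _]]]; apply: retract_stable fK. Qed.

Lemma stable_refl U : stable_retract U U.
Proof. exact/iso_stable/iso_refl. Qed.

(** Substituting one decomposition of the identity into the other leaves two correction terms, which
    are collected on [dsum Q Q']. *)
Lemma stable_trans V U W :
  stable_retract U V -> stable_retract V W -> stable_retract U W.
Proof.
move=> [Q [i [r [a [b [[pQ ri rr ra rb] E]]]]]].
move=> [Q' [i' [r' [a' [b' [[pQ' ri' rr' ra' rb'] E']]]]]].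
have [a2 ra2 aE] := rhom_col ra (rhom_comp ri ra').
have [b2 rb2 bE] := rhom_row rb (rhom_comp rb' rr).
exists (dsum Q Q'), (i' \o i)%VF, (r \o r')%VF, a2, b2; split.
  by split=> //; [exact: projective_dsum|exact: rhom_comp|exact: rhom_comp].
move=> x; rewrite bE aE !comp_lfunE /= -[RHS]E -[in RHS](E' (i x)) linearD /=.
by rewrite -addrA; congr (_ + _); rewrite addrC.
Qed.

Lemma stable_dsumP U P : projective P -> stable_retract (dsum U P) U.
Proof.
move=> pP; have [i1 [i2 [p1 [p2 [[r1 r2 s1 s2] [E1 E2 F1 F2]]]]]] := dsum_rhoms U P.
exists P, p1, i1, p2, i2; split=> // -[x y]; rewrite E1 E2 F1 F2.
by congr pair; [exact: addr0|exact: add0r].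
Qed.

(** From right to left, the pair [(i, a)] embeds [U] into [dsum V P] and is split by the row
    [(r, b)], whose kernel is the complement. *)
Lemma stable_summandP U V : stable_summand U V <-> stable_retract U V.
Proof.
split.
  move=> [P [pP [W /iso_inv[f [g [rf rg fK gK]]]]]].
  have [i1 [i2 [p1 [p2 [[r1 r2 s1 s2] [E1 E2 F1 F2]]]]]] := dsum_rhoms U W.
  apply: (@stable_trans (dsum V P)); last exact: stable_dsumP.
  apply: (@retract_stable U _ (f \o i1)%VF (p1 \o g)%VF); try exact: rhom_comp.
  by move=> x; rewrite !comp_lfunE fK F1 E1.
move=> [P [i [r [a [b [[pP ri rr ra rb] E]]]]]].
exists P; split=> //.
have [j rj jE] := rhom_col ri ra; have [s rs sE] := rhom_row rr rb.
have sj x : s (j x) = x by rewrite sE jE; exact: E.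
have [W [w [rw jw ew]]] := ker_rmod rs.
exists W; have [h rh hE] := rhom_row rj rw; exists h; split=> //.
  apply/eqP/lker0P=> -[u x] [u' x']; rewrite !hE /= => eq.
  have sw y : s (w y) = 0 by apply: exact0.
  have uu : u = u' by have := congr1 s eq; rewrite !linearD /= !sj !sw !addr0.
  by move: eq; rewrite uu => /addrI/((injP w).1 jw) ->.
apply/surjP=> y; have : s (y - j (s y)) = 0 by rewrite linearB /= sj subrr.
by move/((exactP _ _).1 ew)=> [x wx]; exists (s y, x); rewrite hE /= wx addrC subrK.
Qed.

Lemma projective_stable P V : projective P -> stable_retract P V.
Proof.
move=> pP; exists P, 0, 0, \1%VF, \1%VF; split; last first.
  by move=> x; rewrite !id_lfunE zero_lfunE add0r.
by split=> //; try exact: rhom0; exact: rhom_id.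
Qed.

(* Both composites and the identity lift along the projective presentations;
   the difference of two lifts of the same map lands in the syzygy, hence
   factors through the projective in the middle. *)
Lemma stable_syz M N S T : stable_retract M N -> is_syz M S -> is_syz N T ->
  stable_retract S T.
Proof.
move=> [Q [i [r [a [b [[pQ ri rr ra rb] E]]]]]].
move=> [P [s [p [pP [rs rp js es sp]]]]] [P' [t [p' [pP' [rt rp' jt et sp']]]]].
have [i1 ri1 iE1] := projective_lift pP rp' (rhom_comp rp ri) sp'.
have [r1 rr1 rE1] := projective_lift pP' rp (rhom_comp rp' rr) sp.
have [b1 rb1 bE1] := projective_lift pQ rp rb sp.
have [i2 ri2 iE2] : exists2 h : 'Hom(S, T), is_rhom h & forall x, t (h x) = i1 (s x).
  have [|h rh hE] := rhom_fact rt jt (rhom_comp rs ri1).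
    move=> x; apply/((exactP _ _).1 et); rewrite comp_lfunE iE1 comp_lfunE.
    by rewrite (exact0 _ es) linear0.
  by exists h => // x; rewrite hE comp_lfunE.
have [r2 rr2 rE2] : exists2 h : 'Hom(T, S), is_rhom h & forall x, s (h x) = r1 (t x).
  have [|h rh hE] := rhom_fact rs js (rhom_comp rt rr1).
    move=> x; apply/((exactP _ _).1 es); rewrite comp_lfunE rE1 comp_lfunE.
    by rewrite (exact0 _ et) linear0.
  by exists h => // x; rewrite hE comp_lfunE.
pose f : 'Hom(P, P) := (\1 - ((r1 \o i1) + (b1 \o (a \o p))))%VF.
have rf : is_rhom f.
  apply: rhomD; first exact: rhom_id.
  by apply/rhomN/rhomD; repeat apply: rhom_comp.
have fE x : f x = x - (r1 (i1 x) + b1 (a (p x))).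
  by rewrite add_lfunE opp_lfunE add_lfunE !comp_lfunE id_lfunE.
have [c rc cE] : exists2 h : 'Hom(P, S), is_rhom h & forall x, s (h x) = f x.
  apply: rhom_fact => // x; apply/((exactP _ _).1 es); rewrite fE linearB /=.
  by rewrite linearD /= rE1 comp_lfunE iE1 bE1 comp_lfunE E subrr.
(* The correction term is [c \o s], which passes through [P]; the summand of [f] through [Q]
   vanishes on [S] because [p] does. *)
exists P, i2, r2, s, c; split=> // x; apply: ((injP s).1 js).
rewrite linearD /= rE2 iE2 cE fE (exact0 _ es) linear0 linear0 addr0.
by rewrite addrC subrK.
Qed.

Lemma stable_syzN n M N S T : stable_retract M N ->
  is_syzN n M S -> is_syzN n N T -> stable_retract S T.
Proof.
move=> MN; elim: n S T => [|n IH] S T /=.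
  move=> SM /iso_sym NT; apply: (stable_trans (iso_stable SM)).
  exact: (stable_trans MN (iso_stable NT)).
move=> [S' [sS' sS]] [T' [sT' sT]].
exact: stable_syz (IH _ _ sS' sT') sS sT.
Qed.

(** * Modules of finite [j]-dell *)

Definition fin_dell j M : Prop := exists n N S T,
  [/\ is_syzN n M S, is_syzN (n + j) N T & stable_retract S T].

(** Any two [n]-th syzygies of a module are stable retracts of each other, so minimal ones may be
    exchanged for arbitrary ones. *)
Lemma fin_dellP j M : dell j M <> None <-> fin_dell j M.
Proof.
split=> [/enat_inf_fin[n [N [S [T [/OmegaN_syzN oS /OmegaN_syzN oT /stable_summandP]]]]] |].
  by exists n, N, S, T.
move=> [n [N [S [T [oS oT ST]]]]]; apply/enat_inf_fin; exists n, N.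
have [S' oS'] := OmegaN_exists n M; have [T' oT'] := OmegaN_exists (n + j) N.
exists S', T'; split=> //; apply/stable_summandP.
apply: (stable_trans (stable_syzN (stable_refl M) (OmegaN_syzN oS') oS)).
exact: (stable_trans ST (stable_syzN (stable_refl N) oT (OmegaN_syzN oT'))).
Qed.

Lemma fin_dell_stable j M N : stable_retract M N -> fin_dell j N -> fin_dell j M.
Proof.
move=> MN [n [X [S [T [oS oT ST]]]]]; have [S' oS'] := syzN_exists n M.
by exists n, X, S', T; split=> //; apply: (stable_trans (stable_syzN MN oS' oS)).
Qed.

(** The same [n] works after shifting both sides by one: an [n]-th syzygy of [X] is an [n.+1]-st one
    of [M], and [N] is replaced by its syzygy [N']. *)
Lemma fin_dell_syz j M X : fin_dell j M -> is_syz M X -> fin_dell j X.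
Proof.
move=> [n [N [S [T [oS oT ST]]]]] sX.
have [N' sN] := syz_exists N; have [S0 oS0] := syzN_exists n X.
have [T0 oT0] := syzN_exists (n + j) N'.
have [S1 oS1] := syz_exists S; have [T1 oT1] := syz_exists T.
exists n, N', S0, T0; split=> //.
apply: (@stable_trans S1).
  by apply: (stable_syzN (stable_refl M) (syzN_syz sX oS0)); exists S.
apply: (stable_trans (stable_syz ST oS1 oT1)).
apply: (stable_syzN (stable_refl N) _ (syzN_syz sN oT0)); by exists T.
Qed.

Lemma fin_dell_projective j P : projective P -> fin_dell j P.
Proof.
move=> pP; have [T oT] := syzN_exists (0 + j) P.
exists 0%N, P, P, T; split=> //; first exact: iso_refl.
exact: projective_stable.
Qed.

End Projectives.

(** * Short exact sequences and resolutions by modules of finite dell *)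

Section Resolutions.
Variables (K : fieldType) (A : falgType K).
Implicit Types M N P Q S T U V W X Y Z : rmod A.

(** With [l] lifting [p] along [g], the map onto [N] is the row [(f, l)]. A pair in its kernel has
    its [P]-coordinate in [S], and since [f] is injective this determines the [M]-coordinate. *)
Lemma syz_extension (M N X P S : rmod A) (f : 'Hom(M, N)) (g : 'Hom(N, X))
    (i : 'Hom(S, P)) (p : 'Hom(P, X)) :
    short_exact f g -> projective P -> short_exact i p ->
  exists (i' : 'Hom(S, dsum M P)) (p' : 'Hom(dsum M P, N)), short_exact i' p'.
Proof.
move=> [rf rg jf ef sg] pP [ri rp ji ei sp].
have [l rl lE] := projective_lift pP rg rp sg.
have [p' rp' pE] := rhom_row rf rl.
have [|u ru uE] := rhom_fact rf jf (rhom_comp ri rl).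
  move=> x; apply/((exactP _ _).1 ef).
  by rewrite comp_lfunE lE (exact0 _ ei).
have [i' ri' iE] := rhom_col (rhomN ru) ri.
exists i', p'; split=> //.
- apply/injP=> x y; rewrite !iE => -[_]; exact: ((injP i).1 ji).
- apply/exactP=> -[m x]; rewrite pE /=; split=> [eq|[y]].
    have /((exactP _ _).1 ei)[y yx] : p x = 0.
      by rewrite -lE -[l x](addKr (f m)) eq addr0 linearN /= (exact0 _ ef) oppr0.
    exists y; rewrite iE yx opp_lfunE; congr pair; apply: ((injP f).1 jf).
    rewrite linearN /= uE comp_lfunE yx; apply/eqP.
    by rewrite eq_sym -addr_eq0 eq.
  rewrite iE => -[<- <-]; rewrite opp_lfunE linearN /= uE comp_lfunE.
  exact: addNr.
apply/surjP=> y; have [x gx] := (surjP p).1 sp (g y).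
have /((exactP _ _).1 ef)[m fm] : g (y - l x) = 0.
  by rewrite linearB /= lE gx subrr.
by exists (m, x); rewrite pE /= fm subrK.
Qed.

(** [Z] is the preimage under [q] of the image of [f]: it maps onto [M], and what it loses is the
    kernel of [q]. *)
Lemma pullback_extension (M N X S T : rmod A) (f : 'Hom(M, N)) (g : 'Hom(N, X))
    (j : 'Hom(S, T)) (q : 'Hom(T, N)) :
    short_exact f g -> short_exact j q ->
  exists Z (z : 'Hom(Z, T)) (s : 'Hom(S, Z)) (u : 'Hom(Z, M)),
    short_exact z (g \o q)%VF /\ short_exact s u.
Proof.
move=> [rf rg jf ef sg] [rj rq jj ej sq].
have rgq := rhom_comp rq rg.
have [|Z [z ez]] := short_exact_ker rgq.
  by rewrite /surj_hom limg_comp sq.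
have [rz _ jz ez' _] := ez.
have [|s rs sE] := rhom_fact rz jz rj.
  move=> x; apply/((exactP _ _).1 ez').
  by rewrite comp_lfunE (exact0 _ ej) linear0.
have [|u ru uE] := rhom_fact rf jf (rhom_comp rz rq).
  move=> x; apply/((exactP _ _).1 ef).
  by rewrite comp_lfunE -comp_lfunE (exact0 _ ez').
exists Z, z, s, u; split=> //; split=> //.
- apply/injP=> x y /(congr1 z); rewrite !sE; exact: ((injP j).1 jj).
- apply/exactP=> y; split=> [uy|[x <-]].
    have /((exactP _ _).1 ej)[x xE] : q (z y) = 0.
      by rewrite -comp_lfunE -uE uy linear0.
    by exists x; apply: ((injP z).1 jz); rewrite sE.
  by apply: ((injP f).1 jf); rewrite uE comp_lfunE sE (exact0 _ ej) linear0.
apply/surjP=> m; have [t tE] := (surjP q).1 sq (f m).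
have /((exactP _ _).1 ez')[y yE] : (g \o q)%VF t = 0.
  by rewrite comp_lfunE tE (exact0 _ ef).
by exists y; apply: ((injP f).1 jf); rewrite uE comp_lfunE yE.
Qed.

Lemma short_exact_iso M N X Y (f : 'Hom(M, N)) (g : 'Hom(N, X)) (h : 'Hom(X, Y)) :
    is_rhom h -> inj_hom h -> surj_hom h ->
  short_exact f g -> short_exact f (h \o g)%VF.
Proof.
move=> rh jh sh [rf rg jf ef sg]; split=> //; first exact: rhom_comp.
  apply/exactP=> y; rewrite comp_lfunE -((exactP _ _).1 ef).
  split=> [E|->]; last by rewrite linear0.
  by apply: ((injP h).1 jh); rewrite linear0.
by rewrite /surj_hom limg_comp sg.
Qed.

Lemma dsum_short_exact M N X P (f : 'Hom(M, N)) (g : 'Hom(N, X)) :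
    short_exact f g ->
  exists (f' : 'Hom(M, dsum N P)) (g' : 'Hom(dsum N P, dsum X P)),
    short_exact f' g'.
Proof.
move=> [rf rg jf ef sg].
have [f' rf' fE] := rhom_col rf (@rhom0 _ _ M P).
have [i1 [i2 [p1 [p2 [[r1 r2 s1 s2] [E1 E2 F1 F2]]]]]] := dsum_rhoms N P.
have [g' rg' gE] := rhom_col (rhom_comp s1 rg) s2.
exists f', g'; split=> //.
- apply/injP=> x y; rewrite !fE => -[+ _]; exact: ((injP f).1 jf).
- apply/exactP=> -[n x]; rewrite gE comp_lfunE F1 F2 /=; split=> [[E ->]|[m]].
    have [m mE] := ((exactP _ _).1 ef _).1 E.
    by exists m; rewrite fE mE zero_lfunE.
  by rewrite fE zero_lfunE => -[<- <-]; rewrite (exact0 _ ef).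
apply/surjP=> -[x y]; have [n nE] := (surjP g).1 sg x.
by exists (n, y); rewrite gE comp_lfunE F1 F2 /= nE.
Qed.

(** A resolution of length [n] cut into short exact sequences, the level rising by one at each
    kernel. Numerical bounds are dropped, as finitely many finite values have a common bound. *)
Fixpoint dell_res n k M : Prop :=
  if n is n'.+1 then exists S (C : rmod A) (i : 'Hom(S, C)) (p : 'Hom(C, M)),
    [/\ short_exact i p, fin_dell k C & dell_res n' k.+1 S]
  else fin_dell k M.

Lemma dell_res_iso n k M N : rmod_iso M N -> dell_res n k M -> dell_res n k N.
Proof.
case: n => [|n] MN /=; first exact/fin_dell_stable/iso_stable/iso_sym.
move=> [S [C [i [p [se fC rS]]]]]; have [h [rh jh sh]] := MN.
by exists S, C, i, (h \o p)%VF; split=> //; apply: short_exact_iso.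
Qed.

Lemma dell_res_dsum n k M P :
  projective P -> dell_res n k M -> dell_res n k (dsum M P).
Proof.
move=> pP; case: n => [|n] /=; first exact/fin_dell_stable/stable_dsumP.
move=> [S [C [i [p [/(dsum_short_exact P)[i' [p' se]] fC rS]]]]].
exists S, (dsum C P), i', p'; split=> //.
exact: fin_dell_stable (stable_dsumP _ pP) fC.
Qed.

(** Let [Q] cover [C] with kernel [Y]. The kernel [Z] of the composite from [Q] to [M] is a syzygy
    of [M] and an extension of [S] by [Y]; a presentation of [S] by [P] with kernel [X] then gives a
    first step [dsum Y P] over [Z], again with kernel [X]. *)
Lemma dell_res_syz n k M : dell_res n k M -> exists X, is_syz M X /\ dell_res n k X.
Proof.
elim: n k M => [|n IH] k M /=.
  by move=> fM; have [X sX] := syz_exists M; exists X; split=> //;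
     apply: fin_dell_syz fM sX.
move=> [S [C [i [p [se fC /IH[X [[P [x [q [pP sx]]]] rX]]]]]]].
have [Y sY] := syz_exists C; have [Q [y [c [pQ sy]]]] := sY.
have [Z [z [s [u [sz su]]]]] := pullback_extension se sy.
exists Z; split; first by exists Q, z, (p \o c)%VF.
have [i' [p' se']] := syz_extension su pP sx.
exists X, (dsum Y P), i', p'; split=> //.
exact: fin_dell_stable (stable_dsumP _ pP) (fin_dell_syz fC sY).
Qed.

Definition fin_ddell k M : Prop := exists n, dell_res n k M.

(** The short exact sequences are spliced: the new differential is the composite of [e] onto the
    kernel [S] with the inclusion [i0]. *)
Lemma dell_res_resolution n k M : dell_res n k M ->
  exists C d e, @resolution K A n M C d e /\
    forall i, (i <= n)%N -> fin_dell (i + k) (C i).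
Proof.
elim: n k M => [|n IH] k M /=.
  move=> fM; have [Z z0] := zero_rmod M.
  have Z0 : fullv = 0%VS :> {vspace Z}.
    by apply/vspaceP=> z; rewrite (z0 z) !mem0v.
  pose C i := if i is _.+1 then Z else M.
  exists C, (fun i => 0), \1%VF; split; last by case.
  split; first by case=> //= i _; rewrite Z0 dimv0.
  - by split=> [|i]; [exact: rhom_id|exact: rhom0].
  - by apply/surjP=> y; exists y; rewrite id_lfunE.
  - apply/exactP=> y; rewrite id_lfunE; split=> [->|[x <-]].
      by exists 0; rewrite linear0.
    by rewrite zero_lfunE.
  move=> i; apply/exactP=> y; split=> _; last by rewrite zero_lfunE.
  by exists 0; rewrite linear0 [RHS]z0.
move=> [S [C0 [i0 [p0 [[ri rp ji ei sp] fC /IH[C [d [e [res fd]]]]]]]]].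
have [C0' [re rd] se ed edd] := res.
pose C' i := if i is i'.+1 then C i' else C0.
pose d' i : 'Hom(C' i.+1, C' i) :=
  if i is i'.+1 return 'Hom(C' i.+1, C' i) then d i' else (i0 \o e)%VF.
exists C', d', p0; split; last first.
  by case=> [|i] // /fd; rewrite addnS.
have exi M' (h : 'Hom(M', S)) y : (i0 (h y) = 0) <-> h y = 0.
  split=> [E|->]; last by rewrite linear0.
  by apply: ((injP i0).1 ji); rewrite linear0.
split=> //.
- by case=> // i /C0'.
- by split=> // -[|i] /=; [exact: rhom_comp|exact: rd].
- apply/exactP=> y; rewrite ((exactP _ _).1 ei); split=> -[x <-].
    by have [c <-] := (surjP e).1 se x; exists c; rewrite comp_lfunE.
  by exists (e x); rewrite comp_lfunE.
case=> [|i] /=; last exact: edd.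
by apply/exactP=> y; rewrite comp_lfunE exi; apply: (exactP _ _).1.
Qed.

Lemma resolution_dell_res n k M C d e : @resolution K A n M C d e ->
  (forall i, (i <= n)%N -> fin_dell (i + k) (C i)) -> dell_res n k M.
Proof.
elim: n k M C d e => [|n IH] k M C d e [C0 [re rd] se ed edd] fd /=.
  (* For length zero [C 1] vanishes, so [e] is an isomorphism. *)
  have je : inj_hom e.
    apply/eqP; rewrite -subv0 -ed; apply/subvP=> y /memv_imgP[x _ ->].
    suff -> : x = 0 by rewrite linear0 mem0v.
    apply/eqP; rewrite -memv0; suff <- : fullv = 0%VS :> {vspace C 1%N} by rewrite memvf.
    by apply/eqP; rewrite -dimv_eq0 C0.
  have iso : rmod_iso M (C 0%N) by apply: iso_sym; exists e.
  exact: fin_dell_stable (iso_stable iso) (fd 0%N isT).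
have [S [i sei]] := short_exact_ker re se.
have [ri _ ji ei _] := sei.
have [|e' re' eE] := rhom_fact ri ji (rd 0%N).
  by move=> x; apply/((exactP _ _).1 ei); rewrite (exact0 _ ed).
exists S, (C 0%N), i, e; split=> //; first exact: (fd 0%N).
apply: (IH k.+1 S (fun i => C i.+1) (fun i => d i.+1) e'); last first.
  by move=> j jn; rewrite addnS; apply: (fd j.+1).
split=> //.
- by move=> j jn; apply: C0.
- apply/surjP=> y; have [x xE] : exists x, d 0%N x = i y.
    by apply/((exactP _ _).1 ed); rewrite (exact0 _ ei).
  by exists x; apply: ((injP i).1 ji); rewrite eE.
apply/exactP=> y; rewrite -((exactP _ _).1 (edd 0%N)) -eE.
split=> [->|E]; first by rewrite linear0.
by apply: ((injP i).1 ji); rewrite linear0.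
Qed.

Lemma fin_ddellP k M : ddell k M <> None <-> fin_ddell k M.
Proof.
split=> [/enat_inf_fin[m [n [_ [C [d [e [res le]]]]]]]|[n]].
  exists n; apply: resolution_dell_res res _ => i /le le_i.
  by apply/fin_dellP=> E; rewrite E in le_i.
move/dell_res_resolution=> [C [d [e [res fd]]]]; apply/enat_inf_fin.
pose v i := odflt 0%N (dell (i + k) (C i)).
(* Subtracting any [i <= n] from this [m] leaves at least the sum, hence at least each single value
   [v i]. *)
exists (n + \sum_(i < n.+1) v i)%N, n; split; first exact: leq_addr.
exists C, d, e; split=> // i le_in; have := (fin_dellP _ _).2 (fd i le_in).
case E: (dell _ _) => [w|] //= _.
apply: (@leq_trans (\sum_(j < n.+1) v j)).
  have -> : w = v (Ordinal (le_in : (i < n.+1)%N)) by rewrite /v /= E.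
  by rewrite (bigD1 (Ordinal (le_in : (i < n.+1)%N))) //= leq_addr.
by rewrite addnC -addnBA // leq_addr.
Qed.

Lemma fin_ddell_step k M S (C : rmod A) (i : 'Hom(S, C)) (p : 'Hom(C, M)) :
  short_exact i p -> fin_dell k C -> fin_ddell k.+1 S -> fin_ddell k M.
Proof. by move=> se fC [n rS]; exists n.+1, S, C, i, p. Qed.

Lemma fin_ddell_iso k M N : rmod_iso M N -> fin_ddell k M -> fin_ddell k N.
Proof. by move=> MN [n rM]; exists n; apply: dell_res_iso rM. Qed.

(** * Closure under extensions, cokernels and kernels *)

Definition all_fin_ddell M : Prop := forall k, (0 < k)%N -> fin_ddell k M.

(** Goodness is inherited only by suitably chosen syzygies, so the chain of choices is recorded,
    starting from [M], for an induction that consumes one per step. *)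
Fixpoint fin_ddell_syzN m k M : Prop :=
  if m is m'.+1 then exists X, is_syz M X /\ fin_ddell_syzN m' k X
  else fin_ddell k M.

Lemma fin_ddell_syzNP m k M : fin_ddell k M -> fin_ddell_syzN m k M.
Proof.
elim: m M => // m IH M [n /dell_res_syz[X [sX rX]]] /=.
by exists X; split=> //; apply: IH; exists n.
Qed.

(** Each round uses one syzygy of [X] and raises the level by one. When the resolution of [M] is
    exhausted, the last syzygy is itself the next kernel, and there it must be good at level
    [n.+1 + k]. *)
Lemma dell_res_ext n k M N X (f : 'Hom(M, N)) (g : 'Hom(N, X)) :
    short_exact f g -> dell_res n k M -> fin_ddell_syzN n.+1 (n.+1 + k) X ->
  fin_ddell k N.
Proof.
elim: n k M N X f g => [|n IH] k M N X f g se rM.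
all: move=> [S [[P [i [p [pP sp]]]] dS]].
all: have [i' [p' sp']] := syz_extension se pP sp.
  apply: (fin_ddell_step sp') dS.
  exact: fin_dell_stable (stable_dsumP _ pP) rM.
have [T [C [j [q [sq fC rT]]]]] := dell_res_dsum pP rM.
have [Z [z [s [u [sz su]]]]] := pullback_extension sp' sq.
apply: (fin_ddell_step sz fC).
by apply: (IH k.+1 _ _ _ _ _ su rT); rewrite addnS.
Qed.

(** The level demanded of [X] depends on the length of the resolution of [M], so [X] is taken good
    at every level while [M] needs only level [k]. *)
Lemma fin_ddell_ext k M N X (f : 'Hom(M, N)) (g : 'Hom(N, X)) :
  short_exact f g -> fin_ddell k M -> all_fin_ddell X -> fin_ddell k N.
Proof.
move=> se [n rM] aX; apply: (dell_res_ext se rM).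
exact/fin_ddell_syzNP/aX.
Qed.

(** The first term [C] over [N] also covers [X], with kernel an extension of [M] by the kernel [T];
    at length zero [N] itself is the first term and [M] the kernel. *)
Lemma fin_ddell_coker k M N X (f : 'Hom(M, N)) (g : 'Hom(N, X)) :
  short_exact f g -> all_fin_ddell M -> fin_ddell k N -> fin_ddell k X.
Proof.
move=> se aM [[|n] rN]; first exact: (fin_ddell_step se rN (aM k.+1 isT)).
have [T [C [j [q [sq fC rT]]]]] := rN.
have [Z [z [s [u [sz su]]]]] := pullback_extension se sq.
apply: (fin_ddell_step sz fC); apply: (fin_ddell_ext su _ aM).
by exists n.
Qed.

Lemma fin_ddell_ker k M N X (f : 'Hom(M, N)) (g : 'Hom(N, X)) :
  short_exact f g -> all_fin_ddell N -> fin_ddell k X -> fin_ddell k M.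
Proof.
move=> se aN [n /dell_res_syz[S [[P [i [p [pP sp]]]] rS]]].
have [i' [p' sp']] := syz_extension se pP sp.
have MP : fin_ddell k (dsum M P).
  by apply: (fin_ddell_ext sp' _ aN); exists n.
have [_ [i2 [p1 [_ [[_ r2 s1 _] [_ E2 F1 _]]]]]] := dsum_rhoms M P.
have sP : short_exact i2 p1.
  split=> //.
  - by apply/injP=> x y; rewrite !E2 => -[].
  - apply/exactP=> -[x y]; rewrite F1 /=; split=> [->|[z]].
      by exists y; rewrite E2.
    by rewrite E2 => -[<-].
  by apply/surjP=> x; exists (x, 0); rewrite F1.
(* The projective [P] is good at every level, by a resolution of length zero. *)
apply: (fin_ddell_coker sP) MP => j _.
by exists 0%N; apply: fin_dell_projective.
Qed.

End Resolutions.

(** * Duality between modules over [L] and over its opposite *)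

Section Codual.
Variables (K : fieldType) (L : falgType K).

Lemma functional_sep (V : vectType K) (v : V) :
  (forall h : 'Hom(V, K^o), h v = 0) -> v = 0.
Proof.
move=> v0; rewrite (coord_vbasis (memvf v)); apply: big1 => i _.
have lc : linear (fun x : V => coord (vbasis {: V}) i x : K^o).
  by move=> c x y; rewrite linearP.
by rewrite -[coord _ _ _](linfun_of lc) v0 scale0r.
Qed.

Lemma dim_functional (V : vectType K) : \dim {: 'Hom(V, K^o)} = \dim {: V}.
Proof. by rewrite !dimvf /dim /= muln1. Qed.

Lemma inj_dim_iso (B : falgType K) (M N : rmod B) (f : 'Hom(M, N)) :
  is_rhom f -> injective f -> \dim {: M} = \dim {: N} -> rmod_iso M N.
Proof.
move=> rf /injP jf d; exists f; split=> //.
apply/eqP; rewrite eqEdim subvf /= limg_dim_eq ?d //.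
by rewrite jf capv0.
Qed.

(* [dual] over [L^c] would start from modules over [L^c^c], whose structure is
   not convertible to that of [L]. *)
Section Def.
Variable X : rmod L.

Definition codual_act (h : 'Hom(X, K^o)) (a : L^c) : 'Hom(X, K^o) :=
  (h \o linfun (fun x : X => ract x (a : L)))%VF.

Lemma codual_actE h a x : codual_act h a x = h (ract x (a : L)).
Proof.
by rewrite comp_lfunE (linfun_of (ract_linearl (a : L))).
Qed.

Fact codual_linearl a : linear (codual_act^~ a).
Proof.
by move=> c f g; apply/lfunP=> v; rewrite !(codual_actE, add_lfunE, scale_lfunE).
Qed.
Fact codual_linearr h : linear (codual_act h).
Proof.
move=> c a b; apply/lfunP=> v; rewrite !(codual_actE, add_lfunE, scale_lfunE).
by rewrite (ract_linearr v c (a : L) b) linearP.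
Qed.
Fact codual_act1 h : codual_act h 1 = h.
Proof. by apply/lfunP=> v; rewrite codual_actE (ract1 v). Qed.
Fact codual_actM h a b : codual_act h (a * b) = codual_act (codual_act h a) b.
Proof.
apply/lfunP=> v; rewrite !codual_actE.
by rewrite -(ractM v (b : L) (a : L)).
Qed.

Definition codual : rmod L^c :=
  @RMod K L^c 'Hom(X, K^o) codual_act codual_linearl codual_linearr
    codual_act1 codual_actM.
End Def.

(** Evaluation is injective since functionals separate points, and the dimensions agree. *)
Lemma dual_codual (X : rmod L) : rmod_iso X (dual (codual X)).
Proof.
pose F (x : X) : 'Hom(codual X, K^o) := linfun (fun h : 'Hom(X, K^o) => h x).
have FE x h : F x h = h x.
  by apply: (linfun_of (F := fun h : 'Hom(X, K^o) => h x)) => c u v;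
     rewrite add_lfunE scale_lfunE.
have [f rf fE] : exists2 f : 'Hom(X, dual (codual X)), is_rhom f & f =1 F.
  apply: rhom_of => [c x y|x a]; apply/lfunP=> h.
    by rewrite add_lfunE scale_lfunE !FE linearP.
  by rewrite FE [RHS]dual_actE FE [RHS]codual_actE.
apply: (inj_dim_iso rf); last by rewrite !dim_functional.
move=> x y; rewrite !fE => /lfunP E; apply/eqP; rewrite -subr_eq0; apply/eqP.
apply: functional_sep => h; rewrite linearB /=.
by have := E h; rewrite !FE => ->; rewrite subrr.
Qed.

(** The pairing of [m] with [x] given by [p x] at [m] is nondegenerate in [m] because [p] is
    surjective; bijectivity of [p] makes the dimensions equal. *)
Lemma codual_dual (X : rmod L) (M : rmod L^c) :
  rmod_iso X (dual M) -> rmod_iso M (codual X).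
Proof.
move=> [p [rp /injP jp /surjP sp]].
pose F (m : M) : 'Hom(X, K^o) := linfun (fun x : X => (p x : 'Hom(M, K^o)) m).
have FE m x : F m x = (p x : 'Hom(M, K^o)) m.
  by apply: (linfun_of (F := fun x : X => (p x : 'Hom(M, K^o)) m)) => c u v;
     rewrite linearP add_lfunE scale_lfunE.
have [f rf fE] : exists2 f : 'Hom(M, codual X), is_rhom f & f =1 F.
  apply: rhom_of => [c m n|m a]; apply/lfunP=> x.
    by rewrite add_lfunE scale_lfunE !FE linearP.
  by rewrite FE [RHS]codual_actE FE rp [RHS]dual_actE.
apply: (inj_dim_iso rf).
  move=> m n; rewrite !fE => /lfunP E; apply/eqP; rewrite -subr_eq0; apply/eqP.
  apply: functional_sep => h; have [x <-] := sp h; rewrite linearB /=.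
  by have := E x; rewrite !FE => ->; rewrite subrr.
rewrite dim_functional -(dim_functional M) -[RHS](limg_dim_eq (f := p)).
  by congr (\dim _); have /surjP -> := sp.
by move/injP: jp => ->; rewrite capv0.
Qed.

Lemma codual_exact (A B C : rmod L) (f : 'Hom(A, B)) (g : 'Hom(B, C)) :
    short_exact f g ->
  exists (g' : 'Hom(codual C, codual B)) (f' : 'Hom(codual B, codual A)),
    short_exact g' f'.
Proof.
move=> [rf rg jf ef sg].
have pre (X Y : rmod L) (u : 'Hom(X, Y)) : is_rhom u ->
  exists2 u' : 'Hom(codual Y, codual X), is_rhom u' &
    forall (h : 'Hom(Y, K^o)) x, (u' h : 'Hom(X, K^o)) x = h (u x).
  move=> ru; have [||u' ru' uE] :=
      @rhom_of _ _ (codual Y) (codual X) (fun h : 'Hom(Y, K^o) => (h \o u)%VF).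
  - by move=> c h k; apply/lfunP=> x;
       rewrite add_lfunE scale_lfunE !comp_lfunE add_lfunE scale_lfunE.
  - move=> h a; apply/lfunP=> x.
    by rewrite comp_lfunE [LHS]codual_actE [RHS]codual_actE comp_lfunE ru.
  by exists u' => // h x; rewrite uE comp_lfunE.
have [g' rg' gE] := pre _ _ _ rg; have [f' rf' fE] := pre _ _ _ rf.
exists g', f'; split=> //.
- apply/injP=> h k E; apply/lfunP=> c; have [b <-] := (surjP g).1 sg c.
  by rewrite -!gE E.
- apply/exactP=> h; split=> [E|[k <-]]; last first.
    by apply/lfunP=> x; rewrite fE gE (exact0 _ ef) linear0 zero_lfunE.
  (* The choice of preimage made by [g^-1] is harmless: it differs from [b] by an element of the
     image of [f], where [h] vanishes. *)
  exists (h \o g^-1)%VF; apply/lfunP=> b; rewrite gE comp_lfunE.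
  have : g ((g^-1)%VF (g b) - b) = 0.
    by rewrite linearB /= limg_lfunVK ?subrr // sg memvf.
  move/((exactP _ _).1 ef)=> [a aE].
  have := fE h a; rewrite E aE linearB zero_lfunE.
  by move/esym/subr0_eq.
(* Elements of the dual are merely [K]-linear, so the [K]-linear pseudo-inverse of [f] suffices to
   extend [h]. *)
apply/surjP=> h; exists (h \o f^-1)%VF; apply/lfunP=> x.
by rewrite fE comp_lfunE lker0_lfunK //; apply/eqP.
Qed.

(** The module whose dual is [X] is unique up to isomorphism, so [codual X] can stand for it. *)
Lemma F_inftyP (X : rmod L) : F_infty X <-> all_fin_ddell (codual X).
Proof.
split=> [[M [dM XM]] k k0|aX].
  by apply: (fin_ddell_iso (codual_dual XM)); apply/fin_ddellP/dM.
exists (codual X); split; last exact: dual_codual.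
by move=> k k0; apply/fin_ddellP/aX.
Qed.

End Codual.

Theorem lemma5p6 (K : fieldType) (L : falgType K) (A B C : rmod L)
    (f : 'Hom(A, B)) (g : 'Hom(B, C)) :
  short_exact f g ->
  [/\ F_infty A -> F_infty B -> F_infty C,
      F_infty A -> F_infty C -> F_infty B
    & F_infty B -> F_infty C -> F_infty A].
Proof.
move=> /codual_exact[g' [f' se]].
(* Duality reverses the sequence: [codual C] is now the submodule and [codual A] the quotient, so
   kernels settle [C] and cokernels settle [A]. *)
split=> /F_inftyP a1 /F_inftyP a2; apply/F_inftyP=> k k0.
- exact: fin_ddell_ker se a2 (a1 k k0).
- exact: fin_ddell_ext se (a2 k k0) a1.
exact: fin_ddell_coker se a2 (a1 k k0).
Qed.
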